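(* Let $X$ be a real Hilbert space and let $A:X\rightrightarrows X$ and $B:X\rightrightarrows X$ be maximally monotone operators. Suppose that $U$ is a closed affine subspace of $X$ and that $A=N_U$. Then the following hold: \begin{enumerate} \item[(i)] For every $n\in\mathbb{N}$, $R_AT_{B,A}^n=T_{A,B}^nR_A$, $T_{B,A}^n=R_AT_{A,B}^nR_A$ and $T_{A,B}^n=R_AT_{B,A}^nR_A$. \item[(ii)] $R_A$ maps $\operatorname{Fix} T_{B,A}$ to $\operatorname{Fix} T_{A,B}$, $Z=J_A(\operatorname{Fix} T_{B,A})$, and $K=(J_A-\operatorname{Id})(\operatorname{Fix} T_{B,A})$. \item[(iii)] Suppose that $V$ is a closed affine subspace of $X$ and that $B=N_V$. Then $T_{A,B}R_AR_B=R_AR_BT_{A,B}$ and $T_{A,B}T_{B,A}=T_{B,A}T_{A,B}$. \end{enumerate}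
   Context: $\operatorname{Id}$ is the identity on $X$. $N_C$ denotes the normal cone operator of a nonempty closed convex subset $C$ of $X$; affine subspaces are nonempty. For a maximally monotone operator $A$, $J_A=(\operatorname{Id}+A)^{-1}$ is the resolvent (single-valued, defined on all of $X$) and $R_A=2J_A-\operatorname{Id}$ is the reflected resolvent. The Douglas--Rachford operator of the ordered pair $(A,B)$ is $T_{A,B}=\tfrac12(\operatorname{Id}+R_BR_A)=\operatorname{Id}-J_A+J_BR_A$; correspondingly $T_{B,A}=\tfrac12(\operatorname{Id}+R_AR_B)$. Products and powers of operators denote composition. $\operatorname{Fix} T=\{x\in X: x=Tx\}$. The sets of primal and dual solutions are $Z=(A+B)^{-1}(0)$ and $K=(A^{-1}+(-\operatorname{Id})\circ B^{-1}\circ(-\operatorname{Id}))^{-1}(0)$. *)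

(* Defs.v *)
From HB Require Import structures.
From mathcomp Require Export all_boot all_order all_algebra.
From mathcomp Require Export all_classical all_reals all_analysis.
Export Order.TTheory GRing.Theory Num.Theory numFieldNormedType.Exports.

Set Implicit Arguments.
Unset Strict Implicit.
Unset Printing Implicit Defensive.

Local Open Scope classical_set_scope.
Local Open Scope ring_scope.

(* Real Hilbert spaces: complete normed modules whose norm comes from an inner
   product.  [{dot X for idfun}] is the type of symmetric positive definite
   bilinear forms on [X]. *)
HB.mixin Record isHilbert (R : realType) X of CompleteNormedModule R X := {
  inner : {dot X for (@idfun R)};
  norm_inner : forall x : X, `|x| ^+ 2 = inner x x
}.

#[short(type="hilbertType")]
HB.structure Definition Hilbert (R : realType) :=
  {X of isHilbert R X & CompleteNormedModule R X}.

(* A set-valued operator X =>> X is a map [A : X -> set X]; [A x u] says that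
   (x, u) lies in the graph of A. *)
Section SetValuedOperators.
Variables (R : realType) (X : hilbertType R).
Implicit Types (A B : X -> set X) (C : set X).

Definition monotone_op A :=
  forall x y u v, A x u -> A y v -> 0 <= inner (x - y) (u - v).

Definition maximally_monotone A :=
  monotone_op A /\
  forall A', monotone_op A' ->
    (forall x, A x `<=` A' x) -> forall x, A' x `<=` A x.

Definition op_inv A : X -> set X := fun u => [set x | A x u].

Definition op_add A B : X -> set X :=
  fun x => [set w | exists u v, [/\ A x u, B x v & w = u + v]].

Definition op_id : X -> set X := fun x => [set x].

Definition op_neg_conj A : X -> set X := fun x => [set - u | u in A (- x)].

Definition zeros A : set X := op_inv A 0.

Definition normal_cone C : X -> set X :=
  fun x => [set u | C x /\ forall c, C c -> inner (c - x) u <= 0].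

Definition affine_subspace C :=
  C !=set0 /\
  forall (t : R) x y, C x -> C y -> C (t *: x + (1 - t) *: y).

(* (Id + A)^-1 read as a function.  For maximally monotone [A] the value set is
   a singleton at every point (Minty); the default 0 is then never used. *)
Definition resolvent A : X -> X :=
  fun x => xget 0 (op_inv (op_add op_id A) x).

Definition refl_resolvent A : X -> X := fun x => 2 *: resolvent A x - x.

Definition DR A B : X -> X :=
  fun x => 2^-1 *: (x + refl_resolvent B (refl_resolvent A x)).

Definition Fix (T : X -> X) : set X := [set x | x = T x].

Definition primal_solutions A B : set X := zeros (op_add A B).

Definition dual_solutions A B : set X :=
  zeros (op_add (op_inv A) (op_neg_conj (op_inv B))).

End SetValuedOperators.

(* Main.v *)
Require Import Defs.
From mathcomp Require Import all_boot all_order all_algebra.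
From mathcomp Require Import all_classical all_reals all_analysis.
From mathcomp Require Import ring lra.
Import Order.TTheory GRing.Theory Num.Theory numFieldNormedType.Exports.

Local Open Scope classical_set_scope.
Local Open Scope ring_scope.

(** Two facts carry the theorem.

    The first is Minty's theorem ([resolvent_graph]): the resolvent of a
    maximally monotone operator is a genuine solution of its defining inclusion
    at every point.  Part (ii) needs it for [B], because a fixed point must
    produce an actual element of [B].  It is proved as a common-point problem
    for balls in X x X.  To each (y, v) in the graph attach the ball with centre
    (y, v) and squared radius t + |y + v|^2, and let t be the least value for
    which all these balls meet, at (p, q) say.  Comparison with the points
    (-v, -y), which lie in all the balls for t' = |y + v|^2 by monotonicity,
    gives t + |p + q|^2 <= 2 <p - y, q - v> for every (y, v) in the graph.
    Maximality forces t >= 0, hence puts (p, q) in the graph, and the inequality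
    at (y, v) = (p, q) then forces q = - p: thus 0 lies in the range of Id + A,
    and a translation gives every other point.  The minimal t is attained
    because uniform convexity makes a minimizing sequence Cauchy
    ([in_all_balls_min]).  In terms of the Fitzpatrick function F of A this is
    the minimization of F(x, u) + (|x|^2 + |u|^2) / 2 with (x, u) = (-q, -p);
    writing it with balls keeps all quantities finite and makes the passage to
    the limit a matter of continuity of the norm.

    The second is that the normal cone of an affine subspace takes linear
    values ([normal_coneP]), so that [R_A] is an involution which preserves
    midpoints.  Applying it to the midpoint of x and R_A (R_B x) gives
    R_A T_{B,A} = (R_A + R_B) / 2 = T_{A,B} R_A, whence (i) by induction.  For
    (ii), x is fixed by T_{B,A} iff R_B x = R_A x iff J_A x and J_B x agree; the
    common value z then satisfies z - x in A z and x - z in B z, and every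
    primal-dual solution pair (z, z - x) arises so.  In (iii) both R_A and R_B
    are midpoint preserving involutions, and the two sides of each identity
    expand to the same average of words in R_A and R_B. *)

(** * Inner product identities *)

Lemma innerC {R : realType} {X : hilbertType R} (x y : X) :
  inner x y = inner y x.
Proof. by rewrite (hermC inner) expr0 mul1r. Qed.

Lemma innerDl {R : realType} {X : hilbertType R} (x y z : X) :
  inner (x + y) z = inner x z + inner y z.
Proof. exact: linearDl. Qed.

Lemma innerDr {R : realType} {X : hilbertType R} (x y z : X) :
  inner z (x + y) = inner z x + inner z y.
Proof. exact: linearDr. Qed.

Lemma innerNl {R : realType} {X : hilbertType R} (x z : X) :
  inner (- x) z = - inner x z.
Proof. exact: linearNl. Qed.

Lemma innerNr {R : realType} {X : hilbertType R} (x z : X) :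
  inner z (- x) = - inner z x.
Proof. exact: linearNr. Qed.

Lemma innerZl {R : realType} {X : hilbertType R} a (x z : X) :
  inner (a *: x) z = a * inner x z.
Proof. exact: linearZl_LR. Qed.

Lemma innerZr {R : realType} {X : hilbertType R} a (x z : X) :
  inner z (a *: x) = a * inner z x.
Proof. exact: linearZr_LR. Qed.

Definition innerE R X := 
  (@innerDl R X, @innerDr R X, @innerNl R X, @innerNr R X,
   @innerZl R X, @innerZr R X).

(** Stewart's identity.  The last term, uniform convexity, is what yields both
    the Cauchy property of minimizing sequences and the strong minimality in
    [in_all_balls_min]. *)
Lemma sqr_norm_convex {R : realType} {X : hilbertType R} (l : R) (a b c : X) :
  `|(1 - l) *: a + l *: b - c| ^+ 2 =
  (1 - l) * `|a - c| ^+ 2 + l * `|b - c| ^+ 2 - l * (1 - l) * `|a - b| ^+ 2.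
Proof.
rewrite !norm_inner !innerE (innerC b a) (innerC c a) (innerC c b).
ring.
Qed.

(** * Least common point of a family of balls *)

Lemma cvg_sqr_dist {R : realType} {X : hilbertType R} (p : nat -> X) :
  (forall N n k, (N <= n)%N -> (N <= k)%N ->
     `|p n - p k| ^+ 2 <= 4 * harmonic N) -> cvg (p @ \oo).
Proof.
move=> Hp; apply: cauchy_cvg; apply: cauchy_exP => e e0.
have /cvgrPdist_lt /(_ (e ^+ 2 / 4)) := @cvg_harmonic R.
case=> [|N _ HN]; first by rewrite divr_gt0 ?exprn_gt0.
exists (p N); exists N => // n /= Nn.
rewrite -ball_normE /ball_/=.
rewrite -(@ltr_pXn2r _ 2) ?nnegrE ?normr_ge0 ?(ltW e0)//.
apply: le_lt_trans (Hp N _ _ (leqnn N) Nn) _.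
have := HN N (leqnn N); rewrite sub0r normrN ger0_norm.
  by rewrite ltr_pdivlMr // mulrC.
by rewrite invr_ge0.
Qed.

(** The squared radii t + |y + v|^2 are those of the Fitzpatrick function: with
    x = -q and u = -p the condition reads
    <x, v> + <y, u> - <y, v> <= (t - |x|^2 - |u|^2) / 2 on the graph of [G]. *)
Definition in_all_balls {R : realType} {X : hilbertType R} (G : X -> set X)
    (t : R) (p q : X) :=
  forall y v, G y v -> `|p - y| ^+ 2 + `|q - v| ^+ 2 <= t + `|y + v| ^+ 2.

Lemma in_all_balls_convex {R : realType} {X : hilbertType R} (G : X -> set X)
    (l t t' : R) (p p' q q' : X) : 0 <= l <= 1 ->
  in_all_balls G t p q -> in_all_balls G t' p' q' ->
  in_all_balls G
    ((1 - l) * t + l * t' - l * (1 - l) * (`|p - p'| ^+ 2 + `|q - q'| ^+ 2))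
    ((1 - l) *: p + l *: p') ((1 - l) *: q + l *: q').
Proof.
move=> l01 H H' y v Gyv; rewrite !sqr_norm_convex.
have {}H := H y v Gyv; have {}H' := H' y v Gyv.
nra.
Qed.

(** The minimum is strong: any competing point pays its squared distance to the
    minimizer.  This is the optimality condition at the minimizer, obtained by
    moving a short way along the segment towards the competitor. *)
Lemma in_all_balls_min {R : realType} {X : hilbertType R} (G : X -> set X)
    (t0 : R) (p0 q0 y0 v0 : X) : G y0 v0 -> in_all_balls G t0 p0 q0 ->
  exists t p q, in_all_balls G t p q /\
    forall t' p' q', in_all_balls G t' p' q' ->
      t + (`|p - p'| ^+ 2 + `|q - q'| ^+ 2) <= t'.
Proof.
move=> Gyv0 F0.
pose E := [set t : R | exists p q, in_all_balls G t p q].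
have hE : has_inf E.
  split; first by exists t0, p0, q0.
  exists (- `|y0 + v0| ^+ 2) => t [p [q /(_ _ _ Gyv0) H]].
  have := sqr_ge0 `|p - y0|; have := sqr_ge0 `|q - v0|; lra.
pose m := inf E.
have mP t p q : in_all_balls G t p q -> m <= t.
  by move=> H; apply: ge_inf; [case: hE | exists p, q].
have /choice[z zP] n :
    exists z : X * X, in_all_balls G (m + harmonic n) z.1 z.2.
  have [|t [p [q H]] tm] := inf_adherent (_ : 0 < @harmonic R n) hE.
    by rewrite invr_gt0.
  exists (p, q) => y v /H /le_trans; apply.
  by rewrite lerD2r ltW.
have z_dist N n k : (N <= n)%N -> (N <= k)%N ->
    `|(z n).1 - (z k).1| ^+ 2 + `|(z n).2 - (z k).2| ^+ 2 <= 4 * harmonic N.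
  have hmono i : (N <= i)%N -> harmonic i <= harmonic N :> R.
    by move=> Ni; rewrite lef_pV2 ?posrE// ler_nat.
  move=> /hmono Nn /hmono Nk.
  (* The midpoint of two almost optimal points cannot beat the infimum. *)
  have h01 : 0 <= (2^-1 : R) <= 1 by lra.
  have := mP _ _ _ (in_all_balls_convex _ _ _ _ _ _ _ _ h01 (zP n) (zP k)).
  lra.
have /cvg_ex[p pP] : cvg ((fun n => (z n).1) @ \oo).
  apply: cvg_sqr_dist => N n k Nn Nk; apply: le_trans (z_dist N n k Nn Nk).
  by rewrite lerDl sqr_ge0.
have /cvg_ex[q qP] : cvg ((fun n => (z n).2) @ \oo).
  apply: cvg_sqr_dist => N n k Nn Nk; apply: le_trans (z_dist N n k Nn Nk).
  by rewrite lerDr sqr_ge0.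
have Fm : in_all_balls G m p q.
  move=> y v Gyv.
  have cl : `|(z n).1 - y| ^+ 2 + `|(z n).2 - v| ^+ 2 @[n --> \oo] -->
            `|p - y| ^+ 2 + `|q - v| ^+ 2.
    apply: cvgD.
      rewrite expr2; apply: cvgM; apply: cvg_norm;
        by apply: cvgB => //; exact: cvg_cst.
    rewrite expr2; apply: cvgM; apply: cvg_norm;
      by apply: cvgB => //; exact: cvg_cst.
  have cr : m + harmonic n + `|y + v| ^+ 2 @[n --> \oo] -->
            m + 0 + `|y + v| ^+ 2.
    apply: cvgD; last exact: cvg_cst.
    by apply: cvgD; [exact: cvg_cst|exact: cvg_harmonic].
  rewrite addr0 in cr.
  by apply: (ler_cvg_to cl cr); apply: nearW => n; exact: zP.
exists m, p, q; split=> // t' p' q' F'.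
set d := (X in m + X); rewrite leNgt; apply/negP => lt.
have mt := mP _ _ _ F'.
have d0 : 0 < d by lra.
(* If t' < m + d, a step of length l towards (p', q') changes the value m by
   l (t' - m - (1 - l) d), and l d = (m + d - t') / 2 makes this negative. *)
pose l := (m + d - t') / (2 * d).
have ld : l * d = (m + d - t') / 2 by rewrite /l; field; lra.
have l0 : 0 < l by rewrite divr_gt0; lra.
have l1 : 0 <= l <= 1 by rewrite (ltW l0) /l ler_pdivrMr; lra.
have := mP _ _ _ (in_all_balls_convex _ _ _ _ _ _ _ _ l1 Fm F'); rewrite -/d.
nra.
Qed.

(** * Minty's theorem *)

Lemma maximally_monotone_mem {R : realType} {X : hilbertType R}
    (A : X -> set X) (x u : X) : maximally_monotone A ->
  (forall y v, A y v -> 0 <= inner (x - y) (u - v)) -> A x u.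
Proof.
move=> [mA maxA] H.
pose A' : X -> set X := fun y => [set v | A y v \/ (y = x /\ v = u)].
apply: (maxA A') => [y y' v v'||]; last by right.
  move=> [Av|[-> ->]] [Av'|[-> ->]].
  - exact: mA.
  - by rewrite -(opprB x y) -(opprB u v) innerNl innerNr opprK; exact: H.
  - exact: H.
  - by rewrite !subrr -norm_inner sqr_ge0.
by move=> y v Av; left.
Qed.

(** Relates the constraint defining the balls to monotonicity: it says that
    (p, q) lies in the ball of (y, v) iff |p + q|^2 - t is at most twice the
    monotonicity pairing of (y, v) with (-q, -p). *)
Lemma sqr_dist_graph {R : realType} {X : hilbertType R} (p q y v : X) :
  `|p - y| ^+ 2 + `|q - v| ^+ 2 =
  `|p + q| ^+ 2 + `|y + v| ^+ 2 - 2 * inner (y + q) (v + p).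
Proof.
rewrite !norm_inner !innerE (innerC y p) (innerC v q) (innerC q p).
rewrite (innerC v y); ring.
Qed.

(** Minty's theorem at the origin: 0 lies in the range of Id + A. *)
Lemma maximally_monotone_range0 {R : realType} {X : hilbertType R}
    (A : X -> set X) : maximally_monotone A -> exists p, A p (- p).
Proof.
move=> maxA; have [mA _] := maxA.
have [y0 [v0 Av0]] : exists y v, A y v.
  apply: contrapT => nA; apply: (nA); exists 0, 0.
  by apply: maximally_monotone_mem => // y v Av; case: nA; exists y, v.
have ball_of_graph y v : A y v -> in_all_balls A (`|y + v| ^+ 2) (- v) (- y).
  move=> Av y' v' Av'; rewrite sqr_dist_graph.
  have := mA _ _ _ _ Av' Av; rewrite -opprD normrN (addrC v y); lra.
(* If t were smaller, (-q, -p) would be strictly monotonically related to the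
   whole graph, hence belong to it, hence to itself. *)
have ball_ge t p q : in_all_balls A t p q -> `|p + q| ^+ 2 <= t.
  move=> F; rewrite leNgt; apply/negP => lt.
  have pos y v : A y v -> 0 < inner (y + q) (v + p).
    move=> /F; rewrite sqr_dist_graph; lra.
  have /pos : A (- q) (- p).
    apply: maximally_monotone_mem => // y v /pos /ltW.
    by rewrite -!opprD innerNl innerNr opprK (addrC q) (addrC p).
  by rewrite (addrC _ q) (addrC _ p) !subrr -norm_inner normr0 expr0n ltxx.
have [t [p [q [F tmin]]]] :=
  in_all_balls_min _ _ _ _ _ _ Av0 (ball_of_graph _ _ Av0).
have t0 : 0 <= t by apply: le_trans (ball_ge _ _ _ F); exact: sqr_ge0.
have key y v : A y v -> t + `|p + q| ^+ 2 <= 2 * inner (p - y) (q - v).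
  move=> Av; have := tmin _ _ _ (ball_of_graph _ _ Av).
  rewrite !norm_inner !opprK !innerE (innerC q p) (innerC v y).
  rewrite (innerC v p) (innerC y q).
  lra.
have Apq : A p q.
  apply: maximally_monotone_mem => // y v /key; have := sqr_ge0 `|p + q|; lra.
have := key _ _ Apq.
rewrite !subrr -norm_inner normr0 expr0n mulr0 => pq.
have /eqP : `|p + q| ^+ 2 == 0 by rewrite eq_le sqr_ge0 andbT; lra.
move=> /eqP; rewrite sqrf_eq0 normr_eq0 addr_eq0 => /eqP pE.
by exists p; rewrite {2}pE opprK.
Qed.

(** Monotonicity alone makes Id + A injective; so, for maximally monotone [A],
    this lemma and [resolvent_graph] together characterize the resolvent. *)
Lemma resolvent_unique {R : realType} {X : hilbertType R} (A : X -> set X)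
    (x p : X) : monotone_op A -> A p (x - p) -> resolvent A x = p.
Proof.
move=> mA Ap; apply: xget_unique => [|p' [_ [w [-> Ap' xE]]]].
  by exists p, (x - p); rewrite addrCA subrr addr0.
move: Ap'; have -> : w = x - p' by rewrite xE addrAC subrr add0r.
move=> /mA /(_ Ap); rewrite opprB (addrC (x - p')) subrKA -(opprB p' p) innerNr.
rewrite -norm_inner oppr_ge0 => le0.
have : `|p' - p| ^+ 2 == 0 by rewrite eq_le le0 sqr_ge0.
by rewrite sqrf_eq0 normr_eq0 subr_eq0 => /eqP.
Qed.

(** Minty's theorem at an arbitrary point [x], from the case of the origin
    applied to the operator with values A y - x. *)
Lemma resolvent_graph {R : realType} {X : hilbertType R} (A : X -> set X)
    (x : X) : maximally_monotone A -> A (resolvent A x) (x - resolvent A x).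
Proof.
move=> [mA maxA].
have [|p Ap] := @maximally_monotone_range0 R X (fun y => [set w | A y (w + x)]).
  split=> [y y' w w' Aw Aw'|A' mA' sub y w A'w].
    by have := mA _ _ _ _ Aw Aw'; rewrite opprD addrACA subrr addr0.
  apply: (maxA (fun y => [set v | A' y (v - x)])) => /= [z z' v v'|z v Av|].
  - by move=> /mA' H /H; rewrite opprB addrA subrK.
  - by apply: sub; rewrite /= subrK.
  - by rewrite addrK.
have {}Ap : A p (x - p) by rewrite addrC.
by rewrite (resolvent_unique _ _ _ mA Ap).
Qed.

(** * Reflection in a closed affine subspace *)

(** An affine subspace contains, with each of its points c, the reflection
    2 p - c of c through p; this turns the inequalities of the normal cone into
    orthogonality to the direction space of [U]. *)
Lemma normal_coneP {R : realType} {X : hilbertType R} (U : set X) (p w : X) :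
  affine_subspace U ->
  normal_cone U p w <->
  U p /\ forall c c', U c -> U c' -> inner (c - c') w = 0.
Proof.
move=> [_ affU]; split=> [[Up le0]|[Up eq0]]; last first.
  by split=> // c Uc; rewrite eq0.
split=> // c c' Uc Uc'.
have perp d : U d -> inner (d - p) w = 0.
  move=> Ud; apply/eqP; rewrite eq_le le0//=.
  (* Coefficient 2 gives the reflection 2 p - d. *)
  have /le0 := affU 2 _ _ Up Ud.
  have -> : 2 *: p + (1 - 2) *: d - p = p - d.
    rewrite scalerBl scale1r !scaler_nat !mulr2n opprD (addrA d) subrr sub0r.
    by rewrite addrAC addrK.
  by rewrite -opprB innerNl oppr_le0.
by rewrite -(subrKA p) innerDl perp// -opprB innerNl perp// oppr0 addr0.
Qed.

(** The resolvent of [A] is the projection onto [U]; its existence comes from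
    Minty's theorem applied to the normal cone. *)
Section AffineProjector.
Variables (R : realType) (X : hilbertType R) (A : X -> set X) (U : set X).
Hypotheses (maxA : maximally_monotone A) (affU : affine_subspace U).
Hypothesis AE : A = normal_cone U.

Let monoA : monotone_op A. Proof. by case: maxA. Qed.

Let graphP (p w : X) :
  A p w <-> U p /\ forall c c', U c -> U c' -> inner (c - c') w = 0.
Proof. by rewrite AE; exact: normal_coneP. Qed.

Lemma normal_cone_affineN (p w : X) : A p w -> A p (- w).
Proof.
move=> /graphP[Up perp].
by apply/graphP; split=> // c c' ? ?; rewrite innerNr perp ?oppr0.
Qed.

Lemma refl_resolventK : involutive (refl_resolvent A).
Proof.
move=> x; rewrite {1}/refl_resolvent.
have -> : resolvent A (refl_resolvent A x) = resolvent A x.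
  apply: resolvent_unique => //; rewrite /refl_resolvent scaler_nat mulr2n.
  rewrite addrAC addrK -opprB; apply: normal_cone_affineN.
  exact: resolvent_graph.
by rewrite /refl_resolvent opprB addrC subrK.
Qed.

Lemma resolvent_midpoint (x y : X) :
  resolvent A (2^-1 *: (x + y)) = 2^-1 *: (resolvent A x + resolvent A y).
Proof.
apply: resolvent_unique => //; rewrite -scalerBr opprD addrACA.
have := resolvent_graph _ x maxA; have := resolvent_graph _ y maxA.
move=> /graphP[Uy perpy].
move=> /graphP[Ux perpx].
apply/graphP; split.
  rewrite scalerDr.
  have -> : 2^-1 *: resolvent A y = (1 - 2^-1) *: resolvent A y.
    by congr (_ *: _); lra.
  by case: affU => _; apply.
by move=> c c' Uc Uc'; rewrite innerZr innerDr perpx ?perpy ?addr0 ?mulr0.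
Qed.

Lemma refl_resolvent_midpoint (x y : X) :
  refl_resolvent A (2^-1 *: (x + y)) =
  2^-1 *: (refl_resolvent A x + refl_resolvent A y).
Proof.
rewrite /refl_resolvent resolvent_midpoint.
by rewrite addrACA -scalerDr -opprD scalerBr !scalerA mulrC.
Qed.

(** Both sides are the average of the reflections of A and B. *)
Lemma refl_resolvent_DR (B : X -> set X) (x : X) :
  refl_resolvent A (DR B A x) = DR A B (refl_resolvent A x).
Proof. by rewrite /DR refl_resolvent_midpoint !refl_resolventK. Qed.

Lemma refl_resolvent_iter_DR (B : X -> set X) (n : nat) (x : X) :
  refl_resolvent A (iter n (DR B A) x) = iter n (DR A B) (refl_resolvent A x).
Proof. by elim: n => //= n IH; rewrite refl_resolvent_DR IH. Qed.

(** * Fixed points and solutions *)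

Lemma Fix_DRP (B : X -> set X) (x : X) :
  Fix (DR B A) x <-> resolvent A x = resolvent B x.
Proof.
have midE (y : X) : x = 2^-1 *: (x + y) <-> x = y.
  split=> [e|<-].
    have : 2 *: x = x + y by rewrite {1}e scalerA mulfV ?scale1r.
    by rewrite scaler_nat mulr2n => /addrI.
  by rewrite -(mulr2n x) -(scaler_nat 2 x) scalerA mulVf ?scale1r.
rewrite /Fix /= midE; split=> [xE|JE].
  have : refl_resolvent A x = refl_resolvent B x.
    by rewrite {1}xE refl_resolventK.
  move=> /addIr /(congr1 (fun z => 2^-1 *: z)).
  by rewrite !scalerA mulVf ?scale1r.
by rewrite {2}/refl_resolvent -JE -/(refl_resolvent A x) refl_resolventK.
Qed.

Lemma primal_solutions_Fix_DR (B : X -> set X) : maximally_monotone B ->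
  primal_solutions A B = resolvent A @` Fix (DR B A).
Proof.
move=> maxB; have [monoB _] := maxB; apply/seteqP; split=> z.
  move=> [u [v [Au Bv uv]]]; have vE : v = - u.
    by apply/eqP; rewrite -addr_eq0 addrC -uv.
  have JA : resolvent A (z - u) = z.
    apply: resolvent_unique => //.
    by rewrite addrAC subrr add0r; exact: normal_cone_affineN.
  exists (z - u) => //; apply/Fix_DRP; rewrite JA; apply/esym.
  by apply: resolvent_unique => //; rewrite addrAC subrr add0r -vE.
move=> [x /Fix_DRP JE <-].
exists (resolvent A x - x), (x - resolvent A x); split.
- by rewrite -opprB; apply: normal_cone_affineN; exact: resolvent_graph.
- by rewrite JE; exact: resolvent_graph.
- by rewrite -(opprB x) addNr.
Qed.

Lemma dual_solutions_Fix_DR (B : X -> set X) : maximally_monotone B ->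
  dual_solutions A B = (fun x => resolvent A x - x) @` Fix (DR B A).
Proof.
move=> maxB; have [monoB _] := maxB; apply/seteqP; split=> k.
  move=> [u [_ [Au [v Bv <-] uv]]].
  have vE : v = u by apply/esym/eqP; rewrite -subr_eq0 -uv.
  rewrite /op_inv /= in Au; rewrite {}vE /op_inv /= in Bv.
  have JA : resolvent A (u - k) = u.
    apply: resolvent_unique => //.
    by rewrite addrAC subrr add0r; exact: normal_cone_affineN.
  exists (u - k); last by rewrite JA opprB addrC subrK.
  apply/Fix_DRP; rewrite JA; apply/esym.
  by apply: resolvent_unique => //; rewrite addrAC subrr add0r.
move=> [x /Fix_DRP JE <-].
exists (resolvent A x), (- resolvent A x); split; last by rewrite subrr.
- rewrite /op_inv /= -opprB; apply: normal_cone_affineN.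
  exact: resolvent_graph.
- exists (resolvent A x) => //.
  by rewrite /op_inv /= opprB JE; exact: resolvent_graph.
Qed.

End AffineProjector.

(** * The theorem *)

Theorem theorem2p6 (R : realType) (X : hilbertType R) (A B : X -> set X)
    (maxA : maximally_monotone A) (maxB : maximally_monotone B)
    (U : set X) (closedU : closed U) (affineU : affine_subspace U)
    (AE : A = normal_cone U) :
  (* (i) *)
  (forall n : nat,
     [/\ refl_resolvent A \o iter n (DR B A) =1
           iter n (DR A B) \o refl_resolvent A,
         iter n (DR B A) =1
           refl_resolvent A \o iter n (DR A B) \o refl_resolvent A
       & iter n (DR A B) =1
           refl_resolvent A \o iter n (DR B A) \o refl_resolvent A]) /\
  (* (ii) *)
  [/\ refl_resolvent A @` Fix (DR B A) `<=` Fix (DR A B),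
      primal_solutions A B = resolvent A @` Fix (DR B A)
    & dual_solutions A B =
        (fun x => resolvent A x - x) @` Fix (DR B A)] /\
  (* (iii) *)
  (forall V : set X, closed V -> affine_subspace V -> B = normal_cone V ->
     DR A B \o refl_resolvent A \o refl_resolvent B =1
       refl_resolvent A \o refl_resolvent B \o DR A B /\
     DR A B \o DR B A =1 DR B A \o DR A B).
Proof.
have RAK := refl_resolventK _ _ _ _ maxA affineU AE.
have RAiter := refl_resolvent_iter_DR _ _ _ _ maxA affineU AE B.
have RAmid := refl_resolvent_midpoint _ _ _ _ maxA affineU AE.
split=> [n|].
  split=> x /=.
  - exact: RAiter.
  - by rewrite -RAiter RAK.
  - by rewrite RAiter RAK.
split=> [|V closedV affineV BE].
  split.
  - move=> _ [x xE <-]; rewrite /Fix /=.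
    by rewrite -(refl_resolvent_DR _ _ _ _ maxA affineU AE) -xE.
  - exact: (primal_solutions_Fix_DR _ _ _ _ maxA affineU AE).
  - exact: (dual_solutions_Fix_DR _ _ _ _ maxA affineU AE).
have RBK := refl_resolventK _ _ _ _ maxB affineV BE.
have RBmid := refl_resolvent_midpoint _ _ _ _ maxB affineV BE.
split=> x /=.
  by rewrite /DR RBmid RAmid !RAK !RBK RAK.
rewrite /DR !RAmid !RBmid !RAmid !RAK !RBK !RAK.
by rewrite -!scalerDr addrACA.
Qed.
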